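(* Let $E$ be a $d$-dimensional non-compact connected complete Riemannian manifold with Ricci curvature bounded from below, let $\rho(x)$ be the Riemannian distance between $x$ and a fixed point $o\in E$, and let $\mu(dx)=Ze^{V}dx$ be a probability measure on $E$, where $V$ is a continuous function on $E$ such that $V+\theta\rho^\gamma$ is bounded for some $\gamma\in(1,2]$ and $\theta>0$, $dx$ is the Riemannian volume measure and $Z$ is the normalization. Let $\mathcal{E}(f,f)=\mu(|\nabla f|^2)$ with domain $\mathrm{Dom}(\mathcal{E})=H^{1,2}(\mu)$, and let $\beta>0$ be a constant such that for all $q\in[1,2)$ and all nonnegative $g\in\mathrm{Dom}(\mathcal{E})$, $$\beta(2-q)^{2/\gamma-1}\bigl(\mu(g^2)-\mu(g^q)^{2/q}\bigr)\le(2-q)\,\mathcal{E}(g,g).$$ Then there exists a constant $C$, depending only on $\beta$, such that for any smooth function $f\colon E\to\mathbb{R}$ and all $r\ge2$, $$\|f-\mu(f)\|_r\le C r^{1/\gamma}\,\|\nabla f\|_r,$$ where the norms are taken in $L_r(E,\mu)$.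
   Context: A constant $\beta>0$ as in the claim always exists in this setting, by a theorem of Wang. Notation: $\mu(f)=\int f\,d\mu$; $\|\nabla f\|_r=(\mu(|\nabla f|^r))^{1/r}$. Convention: the estimate means ''if the right-hand side is finite, then the left-hand side is well-defined and the inequality holds''. *)

(* Defs.v *)
From HB Require Import structures.
From mathcomp Require Import all_boot all_order all_algebra.
From mathcomp Require Import all_classical all_reals all_analysis.

Set Implicit Arguments.
Unset Strict Implicit.
Unset Printing Implicit Defensive.

Import Order.TTheory GRing.Theory Num.Theory.
Import numFieldNormedType.Exports.

Local Open Scope classical_set_scope.
Local Open Scope ring_scope.

(** * Calculus on open subsets of R^d *)

Section euclidean.
Context {R : realType} {d : nat}.

Definition partial (i : 'I_d) (g : 'rV[R]_d -> R) : 'rV[R]_d -> R :=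
  'D_(delta_mx 0 i) g.

(* C^oo on the open set U: the iterated partial derivatives of g of all orders
   exist and are continuous at every point of U.  'D is total (a limit with a
   junk default), hence the explicit derivability. *)
Definition smooth_on (U : set 'rV[R]_d) (g : 'rV[R]_d -> R) : Prop :=
  forall (s : seq 'I_d) (y : 'rV[R]_d), U y ->
    {for y, continuous (foldr partial g s)} /\
    (forall i, derivable (foldr partial g s) y (delta_mx 0 i)).

End euclidean.

(* Integral over R^d of a nonnegative Borel function, as the iterated Lebesgue
   integral over the coordinates (Tonelli). *)
Fixpoint integral_rV {R : realType} (d : nat) :
    ('rV[R]_d -> \bar R) -> \bar R :=
  match d with
  | 0 => fun F => F 0
  | d'.+1 => fun F =>
      (\int[lebesgue_measure]_(t in [set: R])
         integral_rV (fun y : 'rV[R]_d' => F (row_mx (t%:M : 'rV[R]_1) y)))%E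
  end.

(** * Riemannian manifolds *)

Record chart (R : realType) (d : nat) (E : topologicalType) := Chart {
  cdom : set E;
  cimg : set 'rV[R]_d;
  cmap : E -> 'rV[R]_d;
  cinv : 'rV[R]_d -> E;
  open_cdom : open cdom;
  open_cimg : open cimg;
  cmap_img : forall x, cdom x -> cimg (cmap x);
  cinv_dom : forall y, cimg y -> cdom (cinv y);
  cmapK : forall x, cdom x -> cinv (cmap x) = x;
  cinvK : forall y, cimg y -> cmap (cinv y) = y;
  cmap_continuous : forall x, cdom x -> {for x, continuous cmap};
  cinv_continuous : forall y, cimg y -> {for y, continuous cinv} }.

Section transition.
Context {R : realType} {d : nat} {E : topologicalType}.
Implicit Types c : chart R d E.

Definition overlap c c' : set 'rV[R]_d := cimg c `&` cinv c @^-1` cdom c'.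

Definition transition c c' : 'rV[R]_d -> 'rV[R]_d := cmap c' \o cinv c.

(* Tangent vectors are row vectors: v in the chart c is v *m J in the
   chart c'. *)
Definition transition_jacobian c c' (y : 'rV[R]_d) : 'M[R]_d :=
  \matrix_(i, j) partial i (fun z => transition c c' z 0 j) y.

End transition.

(* A d-dimensional smooth Riemannian manifold with underlying space E.  The
   metric tensor is given by its Gram matrices in the charts of the atlas, as
   functions of the chart coordinates; [metric c] is only meaningful on
   [cimg c] for c in the atlas.  [chart_at x] is a chosen chart around x, used
   below to evaluate coordinate-independent quantities at x. *)
Record riemannian (R : realType) (d : nat) (E : topologicalType) := Riemannian {
  manifold_hausdorff : hausdorff_space E;
  manifold_second_countable : @second_countable E;
  atlas : set (chart R d E);
  chart_at : E -> chart R d E;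
  chart_at_atlas : forall x, atlas (chart_at x);
  chart_at_dom : forall x, cdom (chart_at x) x;
  transition_smooth : forall c c', atlas c -> atlas c' ->
    forall j, smooth_on (overlap c c') (fun y => transition c c' y 0 j);
  metric : chart R d E -> 'rV[R]_d -> 'M[R]_d;
  metric_smooth : forall c, atlas c ->
    forall i j, smooth_on (cimg c) (fun y => metric c y i j);
  metric_sym : forall c y, atlas c -> cimg c y -> (metric c y)^T = metric c y;
  metric_pos : forall c y, atlas c -> cimg c y ->
    forall v : 'rV[R]_d, v != 0 -> 0 < (v *m metric c y *m v^T) 0 0;
  metric_change : forall c c' y, atlas c -> atlas c' -> overlap c c' y ->
    metric c y = transition_jacobian c c' y *m metric c' (transition c c' y)
                   *m (transition_jacobian c c' y)^T }.

Section riemannian_geometry.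
Context {R : realType} {d : nat} {E : topologicalType}.
Variable M : riemannian R d E.
Implicit Types (c : chart R d E) (f : E -> R) (x : E) (y v : 'rV[R]_d).

Definition tangent_norm c y v : R :=
  Num.sqrt ((v *m metric M c y *m v^T) 0 0).

Definition smooth f : Prop :=
  forall c, atlas M c -> smooth_on (cimg c) (f \o cinv c).

(* (grad f)^j = sum_i (d_i f) g^{ij} *)
Definition gradient c f y : 'rV[R]_d :=
  (\row_i partial i (f \o cinv c) y) *m invmx (metric M c y).

Definition grad_norm f x : R :=
  let c := chart_at M x in
  tangent_norm c (cmap c x) (gradient c f (cmap c x)).

(** Ricci curvature *)

Definition christoffel c (k i j : 'I_d) y : R :=
  2^-1 * \sum_l invmx (metric M c y) k l *
    (partial i (fun z => metric M c z j l) y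
     + partial j (fun z => metric M c z i l) y
     - partial l (fun z => metric M c z i j) y).

Definition ricci c y : 'M[R]_d := \matrix_(i, j)
  \sum_k (partial k (christoffel c k i j) y - partial j (christoffel c k i k) y
    + \sum_l (christoffel c k k l y * christoffel c l i j y
              - christoffel c k j l y * christoffel c l i k y)).

Definition ricci_bounded_below : Prop := exists K : R,
  forall c y v, atlas M c -> cimg c y ->
    K * (v *m metric M c y *m v^T) 0 0 <= (v *m ricci c y *m v^T) 0 0.

(** Riemannian distance *)

Definition velocity c (g : R -> E) (t : R) : 'rV[R]_d :=
  \row_j derive1 (fun s => cmap c (g s) 0 j) t.

(* g restricts to a C^1 curve on a neighbourhood of [0, 1]. *)
Definition C1_curve (g : R -> E) : Prop :=
  forall t : R, 0 <= t <= 1 ->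
    {for t, continuous g} /\
    (forall c, atlas M c -> cdom c (g t) -> forall j,
      (\forall s \near t, derivable (fun s => cmap c (g s) 0 j) s 1) /\
      (\forall s \near t, {for s, continuous (fun s => velocity c g s 0 j)})).

Definition curve_length (g : R -> E) : \bar R :=
  (\int[lebesgue_measure]_(t in `[0%R, 1%R]%classic)
     (tangent_norm (chart_at M (g t)) (cmap (chart_at M (g t)) (g t))
        (velocity (chart_at M (g t)) g t))%:E)%E.

(* p lists the successive pieces, each parametrized by [0, 1], of a piecewise
   C^1 path from x to x'. *)
Fixpoint path_between x x' (p : seq (R -> E)) : Prop :=
  match p with
  | [::] => x = x'
  | g :: p' => [/\ C1_curve g, g 0 = x & path_between (g 1) x' p']
  end.

Definition dist x x' : R :=
  fine (ereal_inf [set l | exists2 p, path_between x x' p &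
                     l = (\sum_(g <- p) curve_length g)%E]).

Definition complete_riemannian : Prop := forall u : nat -> E,
  (forall e : R, 0 < e ->
     exists N : nat, forall m n, (N <= m)%N -> (N <= n)%N ->
       dist (u m) (u n) < e) ->
  exists x, u @ \oo --> x.

End riemannian_geometry.

Notation borel E := (g_sigma_algebraType (@open E)).

Section riemannian_measure.
Context {R : realType} {d : nat} {E : ptopologicalType}.
Variable M : riemannian R d E.
Implicit Types (f g : E -> R).

(* In coordinates dx = sqrt(det g) dy; as E is second countable, this
   determines vol on all Borel sets. *)
Definition riemannian_volume (vol : {measure set (borel E) -> \bar R}) : Prop :=
  forall (c : chart R d E) (A : set (borel E)),
    atlas M c -> measurable A -> A `<=` cdom c ->
    vol A = integral_rV (fun y =>
      (\1_(cimg c `&` cinv c @^-1` A) y * Num.sqrt (\det (metric M c y)))%:E).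

(* H^{1,2}(mu) is the completion of
     {u smooth | mu(u^2) + mu(|grad u|^2) < oo}
   for the norm (mu(u^2) + mu(|grad u|^2))^(1/2), realized inside L^2(mu).
   [H12_approx mu g u]: u is a Cauchy sequence for this norm which tends to g
   in L^2(mu). *)
Definition H12_approx (mu : {measure set (borel E) -> \bar R}) g
    (u : nat -> E -> R) : Prop :=
  [/\ (forall n, smooth M (u n)),
      (forall n, \int[mu]_x ((u n x) ^+ 2)%:E < +oo)%E,
      (forall n, \int[mu]_x ((grad_norm M (u n) x) ^+ 2)%:E < +oo)%E,
      (fun n => \int[mu]_x ((u n x - g x) ^+ 2)%:E)%E @ \oo --> 0%E &
      forall e : R, 0 < e -> exists N : nat, forall m n, (N <= m)%N ->
        (N <= n)%N ->
        (\int[mu]_x ((grad_norm M (u m \- u n) x) ^+ 2)%:E < e%:E)%E].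

(* g belongs to Dom(E) = H^{1,2}(mu) and E(g, g) = e *)
Definition dirichlet_energy (mu : {measure set (borel E) -> \bar R}) g
    (e : R) : Prop :=
  measurable_fun [set: borel E] (g : borel E -> R) /\
  exists2 u, H12_approx mu g u &
    (fun n => \int[mu]_x ((grad_norm M (u n) x) ^+ 2)%:E)%E @ \oo --> e%:E.

End riemannian_measure.

(* Main.v *)
(* Write h = |grad f|, normalised so that mu(h^r) <= 1. Applying the Beckner-type
   inequality to g = w^(r/2), with w >= 1 smooth, bounded and |grad w| <= h, and
   with q = 2 - 2/r, so that g^q = w^(r-1), gives
     mu(w^r) - mu(w^(r-1))^(r/(r-1)) <= r^(2/gamma) mu(w^(r-2) h^2) / beta.
   Since w^(r-2) (a h)^2 <= w^r + (a h)^r with a = k r^(1/gamma), and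
   ((r-1)/r)^(r/gamma) <= 2/3, the bound mu(w^s) <= (k s^(1/gamma))^s passes from
   s = r - 1 to s = r as soon as beta k^2 >= 9; for s <= 2 it follows from the
   case q = 1, which is the Poincare inequality. This is applied to
   w = sqrt(1 + (u - mu(u))^2) with u a bounded truncation of f, and Fatou's
   lemma removes the truncation. The inequality is thus only needed for smooth
   bounded functions, for which membership in H^{1,2} is immediate. *)

Require Import Defs.
From HB Require Import structures.
From mathcomp Require Import all_boot all_order all_algebra.
From mathcomp Require Import all_classical all_reals all_analysis.
From mathcomp Require Import measurable_realfun ring lra.

Set Implicit Arguments.
Unset Strict Implicit.
Unset Printing Implicit Defensive.

Import Order.TTheory GRing.Theory Num.Theory.
Import numFieldNormedType.Exports.
Import HBNNSimple.

Local Open Scope classical_set_scope.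
Local Open Scope ring_scope.

(** * Smooth functions *)

Section smooth_on_closure.
Context {R : realType}.

Lemma derive_line (V : normedModType R) (f : V -> R) (x v : V) :
  'D_v f x = 'D_1 (fun h : R => f (h *: v + x)) 0.
Proof.
rewrite /derive; set a := (fun h => _); set b := (fun h => _).
suff -> : a = b by [].
by apply/funext => h; rewrite /a /b /= addr0 scale0r add0r [h%:A]mulr1.
Qed.

(** Restricting [f] to the line through [x] in direction [v] reduces the claim to the one-variable
    chain rule, so derivability of [f] in that single direction is enough. *)
Lemma is_derive_comp_scalar (V : normedModType R) (f : V -> R) (phi : R -> R)
    (x v : V) (dphi : R) :
  derivable f x v -> is_derive (f x) 1 phi dphi ->
  is_derive x v (phi \o f) (dphi * 'D_v f x).
Proof.
move=> /derivable1P df [dp <-].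
have fx : f (0 *: v + x) = f x by rewrite scale0r add0r.
have dp' : derivable phi (f (0 *: v + x)) 1 by rewrite fx.
split.
  apply/derivable1P/derivable1_diffP.
  apply: (@differentiable_comp _ _ _ _ (fun h : R => f (h *: v + x)) phi).
    exact/derivable1_diffP.
  exact/derivable1_diffP.
rewrite (derive_line (phi \o f)) (derive_line f).
by have := derive1_comp df dp'; rewrite !derive1E fx.
Qed.

Lemma powR_continuous_gt0 (a x : R) : 0 < x ->
  {for x, continuous (fun t : R => t `^ a)}.
Proof.
move=> x0; apply: differentiable_continuous; apply/derivable1_diffP.
by have [] := is_derive1_powR a x0.
Qed.

Context {d : nat}.
Implicit Types (U : set 'rV[R]_d) (f g : 'rV[R]_d -> R).

(** More than continuity: as in [smooth_on], each level also carries the existence of the first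
    partial derivatives, because a derivative that does not exist takes a default value. *)
Definition C0_on U f := forall y, U y ->
  {for y, continuous f} /\ (forall i, derivable f y (delta_mx 0 i)).

Fixpoint Ck_on (n : nat) U f : Prop :=
  match n with
  | 0 => C0_on U f
  | n'.+1 => C0_on U f /\ forall i, Ck_on n' U (partial i f)
  end.

(** [Ck_on] peels off the innermost derivative, which is the last index of the list in [smooth_on];
    hence the use of [rcons]. The order [n] then supports the inductions in the closure proofs
    below. *)
Lemma smooth_onP U f : smooth_on U f <-> forall n, Ck_on n U f.
Proof.
split=> [sf n|sf s].
- elim: n f sf => [|n IH] f sf; first exact: (sf [::]).
  split; first exact: (sf [::]).
  move=> i; apply: IH => s y Uy; have := sf (rcons s i) y Uy.
  by rewrite -cats1 foldr_cat.
- have {sf} : Ck_on (size s) U f by exact: sf.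
  elim/last_ind: s f => [|s i IH] f; first exact.
  by rewrite size_rcons -cats1 foldr_cat => -[_ /(_ i)/IH].
Qed.

Lemma Ck_onW n U f : Ck_on n.+1 U f -> Ck_on n U f.
Proof.
elim: n f => [|n IH] f [f0 f1] //=; split=> // i; exact/IH/f1.
Qed.

(** Near a point of the open set [U] the two functions coincide, hence so do limits and derivatives.
    This lets a derivative formula valid only on [U] stand in for [partial i f] in the closure
    proofs. *)
Lemma Ck_on_ext n U f g : open U -> (forall y, U y -> f y = g y) ->
  Ck_on n U f -> Ck_on n U g.
Proof.
move=> oU; have near_eq a b y : (forall z, U z -> a z = b z) -> U y ->
    {near y, a =1 b :> ('rV[R]_d -> R)}.
  by move=> ab Uy; near=> z; apply: ab; near: z; exact: open_nbhs_nbhs.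
have C0E a b : (forall z, U z -> a z = b z) -> C0_on U a -> C0_on U b.
  move=> ab Ca y Uy; have [ca da] := Ca y Uy; split=> [|i].
    rewrite /prop_for /continuous_at -(ab _ Uy).
    by have /near_eq_cvg/cvg_trans := near_eq _ _ _ ab Uy; apply.
  by apply: near_eq_derivable (da i); exact: near_eq ab Uy.
elim: n f g => [|n IH] f g fg /=; first exact: C0E.
move=> [f0 f1]; split=> [|i]; first exact: C0E fg f0.
apply: IH (f1 i) => y Uy; apply: near_eq_derive; exact: near_eq fg Uy.
Unshelve. all: by end_near. Qed.

Lemma Ck_on_cst n U (a : R) : Ck_on n U (cst a).
Proof.
elim: n a => [|n IH] a /=.
  by move=> y _; split=> [|i]; [exact: cst_continuous|exact: derivable_cst].
split; first by move=> y _; split=> [|i]; [exact: cst_continuous|exact: derivable_cst].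
move=> i; have -> : partial i (cst a) = cst 0 :> ('rV[R]_d -> R).
  by apply/funext => y; rewrite /partial derive_cst.
exact: IH.
Qed.

Lemma Ck_onD n U f g : open U -> Ck_on n U f -> Ck_on n U g ->
  Ck_on n U (f \+ g).
Proof.
move=> oU; have C0D a b : C0_on U a -> C0_on U b -> C0_on U (a \+ b).
  move=> Ca Cb y Uy; have [ca da] := Ca y Uy; have [cb db] := Cb y Uy.
  split=> [|i]; last exact: derivableD.
  by apply: continuousD; [exact: ca|exact: cb].
elim: n f g => [|n IH] f g /=; first exact: C0D.
move=> [f0 f1] [g0 g1]; split=> [|i]; first exact: C0D.
apply: Ck_on_ext (IH _ _ (f1 i) (g1 i)) => // y Uy.
by rewrite /partial /= deriveD//; [exact: (f0 y Uy).2|exact: (g0 y Uy).2].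
Qed.

Lemma Ck_onM n U f g : open U -> Ck_on n U f -> Ck_on n U g ->
  Ck_on n U (f \* g).
Proof.
move=> oU; have C0M a b : C0_on U a -> C0_on U b -> C0_on U (a \* b).
  move=> Ca Cb y Uy; have [ca da] := Ca y Uy; have [cb db] := Cb y Uy.
  split=> [|i]; last exact: derivableM.
  by apply: continuousM; [exact: ca|exact: cb].
elim: n f g => [|n IH] f g /=; first exact: C0M.
(* The Leibniz rule contains [f] and [g] undifferentiated; they are needed one order lower, hence
   [Ck_onW]. *)
move=> fS gS; have [f0 f1] := fS; have [g0 g1] := gS.
split=> [|i]; first exact: C0M.
apply: (@Ck_on_ext _ _ ((f \* partial i g) \+ (g \* partial i f))) => //.
  move=> y Uy; rewrite /partial /= deriveM//.
    exact: (f0 y Uy).2.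
  exact: (g0 y Uy).2.
by apply: Ck_onD => //; apply: IH; rewrite //; exact: Ck_onW.
Qed.

Lemma Ck_on_powR n U f (a : R) : open U -> (forall y, U y -> 0 < f y) ->
  Ck_on n U f -> Ck_on n U (fun y => f y `^ a).
Proof.
move=> oU f_gt0; have C0P b : C0_on U f -> C0_on U (fun y => f y `^ b).
  move=> Cf y Uy; have [cf df] := Cf y Uy; have fy := f_gt0 _ Uy.
  split=> [|i].
    apply: (@continuous_comp _ _ _ f (fun t => t `^ b)); first exact: cf.
    exact: powR_continuous_gt0.
  have [] // := is_derive_comp_scalar (df i) (is_derive1_powR b fy).
(* The exponent is generalised, since the derivative of $f^a$ involves $f^{a-1}$. *)
elim: n a => [|n IH] a /=; first exact: C0P.
move=> fS; have [f0 f1] := fS; split=> [|i]; first exact: C0P.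
apply: (@Ck_on_ext _ _ ((cst a \* (fun y => f y `^ (a - 1))) \* partial i f)) => //.
  move=> y Uy /=.
  by have [_ <-] := is_derive_comp_scalar ((f0 y Uy).2 i)
    (is_derive1_powR a (f_gt0 _ Uy)).
apply: Ck_onM => //; apply: Ck_onM => //; first exact: Ck_on_cst.
apply: IH; exact: Ck_onW.
Qed.

End smooth_on_closure.

(** * Smooth functions on the manifold and the chain rule for the gradient norm *)

Section smooth_manifold.
Context {R : realType} {d : nat} {E : topologicalType}.
Variable M : riemannian R d E.
Implicit Types f g : E -> R.

Lemma smooth_cst (a : R) : smooth M (cst a).
Proof. by move=> c _; apply/smooth_onP => n; exact: Ck_on_cst. Qed.

Lemma smoothD f g : smooth M f -> smooth M g -> smooth M (f \+ g).
Proof.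
move=> sf sg c Mc; apply/smooth_onP => n.
have /smooth_onP/(_ n) fn := sf c Mc; have /smooth_onP/(_ n) gn := sg c Mc.
exact: (@Ck_onD _ _ _ _ (f \o cinv c) (g \o cinv c) (@open_cimg _ _ _ c) fn gn).
Qed.

Lemma smoothM f g : smooth M f -> smooth M g -> smooth M (f \* g).
Proof.
move=> sf sg c Mc; apply/smooth_onP => n.
have /smooth_onP/(_ n) fn := sf c Mc; have /smooth_onP/(_ n) gn := sg c Mc.
exact: (@Ck_onM _ _ _ _ (f \o cinv c) (g \o cinv c) (@open_cimg _ _ _ c) fn gn).
Qed.

Lemma smooth_powR f (a : R) : (forall x, 0 < f x) -> smooth M f ->
  smooth M (fun x => f x `^ a).
Proof.
move=> f_gt0 sf c Mc; apply/smooth_onP => n.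
have /smooth_onP/(_ n) fn := sf c Mc.
by apply: (@Ck_on_powR _ _ _ _ (f \o cinv c) a (@open_cimg _ _ _ c) _ fn) => y _ /=.
Qed.

Lemma smooth_continuous f : smooth M f -> continuous f.
Proof.
move=> sf x; pose c := chart_at M x.
have Mc : atlas M c by exact: chart_at_atlas.
have cx : cdom c x by exact: chart_at_dom.
have fc : {for x, continuous ((f \o cinv c) \o cmap c)}.
  apply: continuous_comp; first exact: cmap_continuous.
  by have [] := sf c Mc [::] (cmap c x) (cmap_img cx).
have ff : \forall z \near x, (f \o cinv c \o cmap c) z = f z.
  near=> z; rewrite /= cmapK//; near: z.
  by apply: open_nbhs_nbhs; split=> //; exact: open_cdom.
have /near_eq_cvg/cvg_trans := ff; apply.
by move: fc; rewrite /prop_for /continuous_at /= (cmapK cx).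
Unshelve. all: by end_near. Qed.

(** In the chosen chart at [x] the chain rule multiplies every partial derivative of [f] by [dphi];
    the gradient is linear in these and the tangent norm is absolutely homogeneous. *)
Lemma grad_norm_comp f (phi : R -> R) (dphi : R) (x : E) : smooth M f ->
  is_derive (f x) 1 phi dphi ->
  grad_norm M (phi \o f) x = `|dphi| * grad_norm M f x.
Proof.
move=> sf dp; rewrite /grad_norm; set c := chart_at M x; set y := cmap c x.
have cx : cdom c x by exact: chart_at_dom.
have Uy : cimg c y by exact: cmap_img.
have fy : (f \o cinv c) y = f x by rewrite /= cmapK.
have -> : gradient M c (phi \o f) y = dphi *: gradient M c f y.
  rewrite /gradient scalemxAl; congr (_ *m _).
  apply/rowP => i; rewrite !mxE.
  have [_ df] := sf c (chart_at_atlas M x) [::] y Uy.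
  move: dp; rewrite -fy => dp.
  by have [_ <-] := is_derive_comp_scalar (df i) dp.
rewrite /tangent_norm -scalemxAl linearZ /= -scalemxAr -scalemxAl scalerA mxE.
by rewrite sqrtrM -?expr2 ?sqr_ge0// sqrtr_sqr.
Qed.

End smooth_manifold.

Section borel_manifold.
Context {R : realType} {E : ptopologicalType}.

Lemma continuous_borel_measurable (f : E -> R) :
  continuous f -> measurable_fun [set: borel E] (f : borel E -> R).
Proof.
move=> /continuousP cf.
apply: (measurability _ (RGenOpens.measurableE R)).
move=> _ [_ [a [b ->] <-]]; rewrite setTI.
by apply: sub_sigma_algebra; apply: cf; exact: interval_open.
Qed.

End borel_manifold.

(** * Integration *)

Section lower_integral.
Context d (T : measurableType d) (R : realType).
Variable mu : {measure set T -> \bar R}.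
Implicit Types F B H : T -> R.

(* No measurability: on nonnegative functions \int is the lower integral. *)
Lemma ge0_le_lower_integral F H : (forall x, 0 <= F x) ->
  (forall x, F x <= H x) -> (\int[mu]_x (F x)%:E <= \int[mu]_x (H x)%:E)%E.
Proof.
move=> F0 FH; have H0 x : 0 <= H x by exact: le_trans (F0 x) (FH x).
rewrite !ge0_integralTE; [|by move=> x; rewrite lee_fin..].
apply: ereal_sup_le => _ [s sF <-]; exists s => // x.
by apply: le_trans (sF x) _; rewrite lee_fin.
Qed.

Lemma lower_integral_le_affine F B H (c : R) : 0 < c ->
  measurable_fun setT B -> (forall x, 0 <= B x) -> (forall x, 0 <= H x) ->
  (forall x, 0 <= F x) -> (forall x, F x <= B x + c * H x) ->
  (\int[mu]_x (F x)%:E <= \int[mu]_x (B x)%:E + c%:E * \int[mu]_x (H x)%:E)%E.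
Proof.
move=> c0 mB B0 H0 F0 FBH.
rewrite [leLHS]ge0_integralTE; last by move=> x; rewrite lee_fin.
apply: ge_ereal_sup => _ [s sF <-].
have {}sF x : s x <= F x by rewrite -lee_fin; exact: sF.
pose k x := c^-1 * Num.max (s x - B x) 0.
have k0 x : 0 <= k x by rewrite mulr_ge0 ?invr_ge0 ?(ltW c0)// le_max lexx orbT.
have mk : measurable_fun setT k.
  by apply: measurable_funM => //; apply: measurable_maxr => //; exact: measurable_funB.
have kH x : k x <= H x.
  rewrite ler_pdivrMl// ge_max mulr_ge0 ?(ltW c0)// andbT.
  by rewrite lerBlDl; exact: le_trans (sF x) (FBH x).
rewrite -integralT_nnsfun.
apply: (@le_trans _ _ (\int[mu]_x ((B x)%:E + c%:E * (k x)%:E))%E).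
  apply: ge0_le_integral => //.
  - by move=> x _; rewrite lee_fin.
  - by apply/measurable_EFinP.
  - under eq_fun do rewrite -EFinM -EFinD.
    by apply/measurable_EFinP; apply: measurable_funD => //; exact: measurable_funM.
  - move=> x _; rewrite -EFinM -EFinD lee_fin /k mulrA divff ?gt_eqF// mul1r.
    by rewrite -lerBlDl le_max lexx.
rewrite ge0_integralD//; last 4 first.
- by move=> x _; rewrite lee_fin.
- exact/measurable_EFinP.
- by move=> x _; rewrite -EFinM lee_fin mulr_ge0// ltW.
- by apply/measurable_EFinP; exact: measurable_funM.
rewrite leeD2l// ge0_integralZl_EFin//; last 3 first.
- by move=> x _; rewrite lee_fin.
- exact/measurable_EFinP.
- exact: ltW.
by rewrite lee_pmul2l ?lte_fin//; exact: ge0_le_lower_integral.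
Qed.

Lemma lower_integralZl_le H (c : R) : 0 < c -> (forall x, 0 <= H x) ->
  (\int[mu]_x (c * H x)%:E <= c%:E * \int[mu]_x (H x)%:E)%E.
Proof.
move=> c0 H0; have := @lower_integral_le_affine (fun x => c * H x) (cst 0) H c c0.
rewrite integral0 add0e; apply=> // x; last by rewrite add0r.
by rewrite mulr_ge0// ltW.
Qed.

End lower_integral.

(** * Passage between $L_r$ norms and integrals of powers *)

Section Lnorm_bounds.
Context d (T : measurableType d) (R : realType).
Variable mu : {measure set T -> \bar R}.
Implicit Types (F : T -> R) (r A : R).

Lemma Lnorm_le F r A : 0 < r -> 0 <= A ->
  (\int[mu]_x (`|F x| `^ r)%:E <= (A `^ r)%:E)%E ->
  (Lnorm mu r%:E (EFin \o F) <= A%:E)%E.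
Proof.
move=> r0 A0 FA; rewrite unlock.
have -> : A%:E = ((A `^ r)%:E `^ r^-1)%E.
  by rewrite poweR_EFin -powRrM mulfV ?gt_eqF// powRr1.
apply: gt0_ler_poweR => //; rewrite ?invr_ge0 ?(ltW r0)//.
- by rewrite in_itv/= leey andbT integral_ge0// => x _; exact: poweR_ge0.
- by rewrite in_itv/= leey andbT lee_fin powR_ge0.
Qed.

Lemma integral_powR_le F r A : 0 < r -> 0 <= A -> (forall x, 0 <= F x) ->
  (Lnorm mu r%:E (EFin \o F) <= A%:E)%E ->
  (\int[mu]_x (F x `^ r)%:E <= (A `^ r)%:E)%E.
Proof.
move=> r0 A0 F0 FA.
have -> : (\int[mu]_x (F x `^ r)%:E = Lnorm mu r%:E (EFin \o F) `^ r)%E.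
  rewrite poweR_Lnorm ?gt_eqF//; apply: eq_integral => x _ /=.
  by rewrite ger0_norm.
rewrite -poweR_EFin; apply: gt0_ler_poweR => //; first exact: ltW.
- by rewrite in_itv/= leey andbT Lnorm_ge0.
- by rewrite in_itv/= leey andbT lee_fin.
Qed.

End Lnorm_bounds.

Section probability_integrals.
Context d (T : measurableType d) (R : realType) (mu : probability T R).
Implicit Types f g : T -> R.

Lemma bounded_integrable f (b : R) : measurable_fun setT f ->
  (forall x, `|f x| <= b) -> mu.-integrable setT (EFin \o f).
Proof.
move=> mf fb; apply: (@le_integrable _ _ _ mu _ _ _ (EFin \o cst b)) => //.
- exact/measurable_EFinP.
- by move=> x _ /=; rewrite lee_fin (le_trans (fb x))// ler_norm.
- exact: finite_measure_integrable_cst.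
Qed.

Lemma Rintegral_cst1 (a : R) : \int[mu]_x a = a.
Proof. by rewrite Rintegral_cst// [X in fine X]probability_setT mulr1. Qed.

(** The centre [m] is arbitrary: the identity is used at the mean, and at [- b] to expand the square
    of the shifted function $f+b$. *)
Lemma Rintegral_centered_sqr f : mu.-integrable setT (EFin \o f) ->
  mu.-integrable setT (EFin \o (fun x => f x ^+ 2)) -> forall m : R,
  \int[mu]_x ((f x - m) ^+ 2) =
  \int[mu]_x (f x ^+ 2) - m * (\int[mu]_x f x) *+ 2 + m ^+ 2.
Proof.
move=> if1 if2 m.
have iD : mu.-integrable setT (EFin \o (fun x => (- (m *+ 2)) * f x + m ^+ 2)).
  exact: (integrableD measurableT (integrableZl measurableT (- (m *+ 2)) if1)
    (finite_measure_integrable_cst mu (m ^+ 2) measurableT)).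
rewrite (eq_Rintegral mu (g := fun x => f x ^+ 2 + ((- (m *+ 2)) * f x + m ^+ 2))); last first.
  by move=> x _ /=; ring.
rewrite RintegralD// RintegralD//; last 2 first.
- exact: (integrableZl measurableT (- (m *+ 2)) if1).
- exact: finite_measure_integrable_cst.
by rewrite RintegralZl// Rintegral_cst1; ring.
Qed.

End probability_integrals.

(** * Moment growth *)

Section powR_inequalities.
Context {R : realType}.
Implicit Types a h r s u v gamma : R.

Lemma powR_le1D h s r : 0 <= h -> 0 <= s <= r -> h `^ s <= 1 + h `^ r.
Proof.
move=> h0 /andP[s0 sr]; have [h1|/ltW h1] := leP h 1.
  rewrite (@le_trans _ _ 1)// ?lerDl ?powR_ge0//.
  by apply: (@le_trans _ _ (1 `^ s)); [rewrite ge0_ler_powR ?nnegrE|rewrite powR1].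
by rewrite (@le_trans _ _ (h `^ r))// ?ler_powR// lerDr.
Qed.

(** The left side is at most the $r$-th power of the larger of [u] and [v], which takes the place of
    Young's inequality. *)
Lemma powR_mul_sqr_le u v r : 0 <= u -> 0 <= v -> 2 <= r ->
  u `^ (r - 2) * v ^+ 2 <= u `^ r + v `^ r.
Proof.
move=> u0 v0 r2; have powE z : 0 <= z -> z `^ (r - 2) * z ^+ 2 = z `^ r.
  move=> z0; rewrite -powR_mulrn// -powRD ?subrK//.
  by apply/implyP => r0; move: r0; rewrite gt_eqF//; lra.
have [uv|/ltW vu] := leP u v.
  rewrite (@le_trans _ _ (v `^ r)) ?lerDr ?powR_ge0// -(powE v)//.
  by rewrite ler_wpM2r ?sqr_ge0// ge0_ler_powR ?nnegrE// subr_ge0.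
rewrite (@le_trans _ _ (u `^ r)) ?lerDl ?powR_ge0// -(powE u)//.
by rewrite ler_wpM2l ?powR_ge0// ler_sqr.
Qed.

(** From $1-1/r\le e^{-1/r}$ the left side is at most $e^{-1/\gamma}$, and $e^{1/\gamma}\ge
    1+1/\gamma\ge 3/2$. *)
Lemma powR_onem_inv_le gamma r : 0 < gamma <= 2 -> 1 <= r ->
  (1 - r^-1) `^ (r / gamma) <= 2 / 3.
Proof.
move=> /andP[g0 g2] r1; have r0 : 0 < r by lra.
have b0 : 0 <= 1 - r^-1 by rewrite subr_ge0 invf_le1.
have e0 : 0 <= r / gamma by rewrite divr_ge0 ?ltW.
apply: (@le_trans _ _ (expR (- r^-1) `^ (r / gamma))).
  by rewrite ge0_ler_powR ?nnegrE ?expR_ge0// expR_ge1Dx.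
rewrite -expRM mulNr mulrA mulVf ?gt_eqF// mul1r expRN.
rewrite -[2 / 3]invrK lef_pV2 ?posrE ?expR_gt0 ?invr_gt0 ?divr_gt0//.
apply: le_trans (expR_ge1Dx _).
have : 2^-1 <= gamma^-1 by rewrite lef_pV2 ?posrE.
by rewrite invf_div; lra.
Qed.

End powR_inequalities.

(** * The Beckner inequality for bounded smooth functions *)

Section beckner.
Context {R : realType} {d : nat} {E : ptopologicalType}.
Variables (M : riemannian R d E) (mu : probability (borel E) R).
Variables beta gamma : R.

Definition beckner : Prop := forall (q : R) (g : E -> R) (e : R),
  1 <= q < 2 -> (forall x, 0 <= g x) -> dirichlet_energy M mu g e ->
  beta * (2 - q) `^ (2 / gamma - 1) *
    ((\int[mu]_x (g x ^+ 2)) - (\int[mu]_x (g x `^ q)) `^ (2 / q))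
  <= (2 - q) * e.

Lemma smooth_measurable (f : E -> R) : smooth M f ->
  measurable_fun [set: borel E] (f : borel E -> R).
Proof. by move=> sf; apply: continuous_borel_measurable; exact: smooth_continuous sf. Qed.

(** The constant sequence [g] serves as approximation: its differences are the constant function 0,
    whose gradient norm vanishes. *)
Lemma smooth_dirichlet_energy (g : E -> R) : smooth M g ->
  (\int[mu]_x (g x ^+ 2)%:E < +oo)%E ->
  (\int[mu]_x (grad_norm M g x ^+ 2)%:E < +oo)%E ->
  dirichlet_energy M mu g (fine (\int[mu]_x (grad_norm M g x ^+ 2)%:E)).
Proof.
move=> sg g2 dg2; split; first exact: smooth_measurable.
exists (fun=> g); last first.
  rewrite fineK; first exact: cvg_cst.
  by rewrite ge0_fin_numE// integral_ge0// => x _; rewrite lee_fin sqr_ge0.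
split=> //.
  have -> : (fun=> \int[mu]_x ((g x - g x) ^+ 2)%:E)%E = cst 0%E :> (nat -> \bar R).
    apply/funext => _ /=; apply: integral0_eq => x _.
    by rewrite subrr expr2 mul0r.
  exact: cvg_cst.
move=> e e0; exists 0%N => _ _ _ _.
rewrite integral0_eq ?lte_fin// => x _.
have -> : g \- g = cst 0 \o g by apply/funext => y; rewrite /= subrr.
by rewrite (@grad_norm_comp _ _ _ M g (cst 0) 0)// normr0 mul0r expr2 mul0r.
Qed.

(** The gradient bound separates an integrable part [B] from a part [c * H] in which only the lower
    integral of [H] is controlled, by 1. The energy is then finite and at most $\mu(B)+c$, and
    boundedness of [g] puts it in the domain. *)
Lemma beckner_smooth (q b c : R) (g B H : E -> R) : beckner -> 1 <= q < 2 ->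
  smooth M g -> (forall x, 0 <= g x <= b) -> 0 < c ->
  mu.-integrable setT (EFin \o B) -> (forall x, 0 <= B x) ->
  (forall x, 0 <= H x) -> (\int[mu]_x (H x)%:E <= 1)%E ->
  (forall x, grad_norm M g x ^+ 2 <= B x + c * H x) ->
  beta * (2 - q) `^ (2 / gamma - 1) *
    ((\int[mu]_x (g x ^+ 2)) - (\int[mu]_x (g x `^ q)) `^ (2 / q))
  <= (2 - q) * (\int[mu]_x B x + c).
Proof.
move=> beck q12 sg gb c0 iB B0 H0 H1 gB.
have mg := smooth_measurable sg.
have Ble : (\int[mu]_x (grad_norm M g x ^+ 2)%:E <= (\int[mu]_x B x + c)%:E)%E.
  have mB : measurable_fun setT (B : borel E -> R).
    by apply/measurable_EFinP; exact: measurable_int iB.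
  apply: le_trans (lower_integral_le_affine mu c0 mB B0 H0 _ gB) _.
    by move=> x; exact: sqr_ge0.
  rewrite EFinD /Rintegral fineK ?leeD2l//; last exact: integrable_fin_num.
  by rewrite -[leRHS]mule1 lee_pmul2l ?lte_fin.
have dg2 := le_lt_trans Ble (ltry _).
have g2 : (\int[mu]_x (g x ^+ 2)%:E < +oo)%E.
  have /integrableP[_] : mu.-integrable setT (EFin \o (fun x => g x ^+ 2)).
    apply: (@bounded_integrable _ _ _ _ _ (b ^+ 2)); first exact: measurable_funX.
    move=> x; have /andP[gx0 gxb] := gb x.
    by rewrite ger0_norm ?sqr_ge0// ler_sqr// nnegrE (le_trans gx0).
  apply: le_lt_trans; rewrite le_eqVlt; apply/orP; left; apply/eqP.
  by apply: eq_integral => x _ /=; rewrite ger0_norm ?sqr_ge0.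
have g0 x : 0 <= g x by have /andP[] := gb x.
apply: le_trans (beck q g _ q12 g0 (smooth_dirichlet_energy sg g2 dg2)) _.
rewrite ler_pM2l; last by case/andP: q12 => _; rewrite subr_gt0.
rewrite -lee_fin fineK// ge0_fin_numE// integral_ge0// => x _.
by rewrite lee_fin sqr_ge0.
Qed.

End beckner.

(** * Smooth truncation *)

Section truncation.
Context {R : realType}.
Implicit Types e t : R.

(** This is $t/\sqrt{1+et^2}$: smooth, bounded by $1/\sqrt e$, a contraction, and convergent to $t$
    as $e\to0$. A cut-off at a fixed level would destroy smoothness. *)
Definition trunc e t : R := t * (1 + e * t ^+ 2) `^ (- 2^-1).

(** The derivative $(1+et^2)^{-3/2}$, written as a product of two factors that lie in $[0,1]$ when
    $e>0$. *)
Definition dtrunc e t : R :=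
  (1 + e * t ^+ 2) `^ (- 2^-1) * (1 - e * t ^+ 2 / (1 + e * t ^+ 2)).

Section positive_parameter.
Variable e : R.
Hypothesis e_gt0 : 0 < e.

Let s_ge1 t : 1 <= 1 + e * t ^+ 2.
Proof. by rewrite lerDl mulr_ge0 ?sqr_ge0// ltW. Qed.

Let s_gt0 t : 0 < 1 + e * t ^+ 2.
Proof. exact: lt_le_trans (s_ge1 t). Qed.

Lemma sqr_trunc t : trunc e t ^+ 2 = t ^+ 2 / (1 + e * t ^+ 2).
Proof.
rewrite exprMn -(powR_mulrn _ (powR_ge0 _ _)) -powRrM.
by rewrite mulNr mulVf ?pnatr_eq0// powR_inv1// ltW.
Qed.

Lemma sqr_trunc_le t : trunc e t ^+ 2 <= t ^+ 2.
Proof. by rewrite sqr_trunc ler_pdivrMr// ler_peMr ?sqr_ge0. Qed.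

Lemma normr_trunc_le t : `|trunc e t| <= `|t|.
Proof.
by rewrite -ler_sqr ?nnegrE// !real_normK ?num_real// sqr_trunc_le.
Qed.

Lemma normr_trunc_bounded t : `|trunc e t| <= Num.sqrt e^-1.
Proof.
rewrite -sqrtr_sqr ler_sqrt ?invr_ge0 ?(ltW e_gt0)// sqr_trunc.
by rewrite ler_pdivrMr// mulrDr mulKf ?gt_eqF// mulr1 lerDr invr_ge0 ltW.
Qed.

Lemma is_derive_trunc (t : R) : is_derive t 1 (trunc e) (dtrunc e t).
Proof.
have dq : is_derive t 1 (fun t => 1 + e * t ^+ 2) (e * t *+ 2).
  by apply: is_derive_eq; rewrite /GRing.scale /=; ring.
have [dq1 dq2] := dq.
have dp : is_derive t 1 (fun t => (1 + e * t ^+ 2) `^ (- 2^-1))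
    (- 2^-1 * (1 + e * t ^+ 2) `^ (- 2^-1 - 1) * (e * t *+ 2)).
  have := is_derive_comp_scalar dq1 (is_derive1_powR (- 2^-1) (s_gt0 t)).
  by rewrite dq2.
apply: is_derive_eq.
rewrite /GRing.scale /= powRB; last by apply/implyP => _; rewrite gt_eqF.
rewrite /dtrunc powRr1 ?(ltW (s_gt0 t))//; field.
by rewrite gt_eqF.
Qed.

Lemma normr_dtrunc_le1 t : `|dtrunc e t| <= 1.
Proof.
have et0 : 0 <= e * t ^+ 2 by rewrite mulr_ge0 ?sqr_ge0// ltW.
have q0 : 0 <= 1 - e * t ^+ 2 / (1 + e * t ^+ 2).
  by rewrite subr_ge0 ler_pdivrMr// mul1r lerDr.
have q1 : 1 - e * t ^+ 2 / (1 + e * t ^+ 2) <= 1.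
  by rewrite lerBlDr lerDl divr_ge0// ltW.
rewrite ger0_norm ?mulr_ge0 ?powR_ge0// mulr_ile1 ?powR_ge0//.
by rewrite -[leRHS](powRr0 (1 + e * t ^+ 2)) ler_powR// oppr_le0.
Qed.

End positive_parameter.

Lemma trunc_cvg t : trunc n.+1%:R^-1 t @[n --> \oo] --> t.
Proof.
rewrite -[X in _ --> X]mulr1 /trunc; apply: cvgM; first exact: cvg_cst.
have := @powR_continuous_gt0 _ (- 2^-1) _ (@ltr01 R).
rewrite /prop_for /continuous_at powR1 => c.
have q : (1 + n.+1%:R^-1 * t ^+ 2) @[n --> \oo] --> (1 : R).
  rewrite -[X in _ --> X]addr0; apply: cvgD; first exact: cvg_cst.
  rewrite -(mul0r (t ^+ 2)); apply: cvgM; last exact: cvg_cst.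
  exact: cvg_harmonic.
exact: cvg_comp q c.
Qed.

Lemma smooth_trunc {d : nat} {E : topologicalType} (M : riemannian R d E)
    (e : R) (f : E -> R) : 0 < e -> smooth M f -> smooth M (trunc e \o f).
Proof.
move=> e0 sf; apply: (smoothM sf); apply: (smooth_powR (- 2^-1)) => [x|].
  by rewrite ltr_pwDl// mulr_ge0 ?sqr_ge0// ltW.
exact: (smoothD (smooth_cst 1) (smoothM (smooth_cst e) (smoothM sf sf))).
Qed.

End truncation.

Lemma fatou_bound d (T : measurableType d) (R : realType)
    (mu : {measure set T -> \bar R}) (F_ : nat -> T -> R) (F : T -> R) (K : \bar R) :
  (forall n, measurable_fun setT (F_ n)) -> (forall n x, 0 <= F_ n x) ->
  (forall x, F_ n x @[n --> \oo] --> F x) ->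
  (forall n, \int[mu]_x (F_ n x)%:E <= K)%E -> (\int[mu]_x (F x)%:E <= K)%E.
Proof.
move=> mF F0 FF FK.
have := @fatou _ T R mu setT measurableT (fun n x => (F_ n x)%:E)
  (fun n => (measurable_EFinP _ _).2 (mF n))
  (fun n x _ => F0 n x).
have -> : (\int[mu]_x limn_einf (fun n => (F_ n x)%:E) = \int[mu]_x (F x)%:E)%E.
  apply: eq_integral => x _.
  have FE : (F_ n x)%:E @[n --> \oo] --> (F x)%:E.
    by apply: cvg_EFin; [near=> n|exact: FF].
  by have [-> _] := cvg_limn_einf_sup FE.
move=> /le_trans; apply; rewrite limn_einf_lim.
apply: lime_le; first exact: is_cvg_einfs.
near=> n; apply: le_trans (FK n).
by apply: ereal_inf_lbound; exists n => /=.
Unshelve. all: by end_near. Qed.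

(** * Moment bounds by induction on the exponent, then removal of the truncation *)

Section moments.
Context {R : realType} {d : nat} {E : ptopologicalType}.
Variables (M : riemannian R d E) (mu : probability (borel E) R).
Variables beta gamma p : R.
Hypothesis beta_gt0 : 0 < beta.
Hypothesis gamma12 : 1 < gamma <= 2.
Hypothesis beck : beckner M mu beta gamma.
Hypothesis p_ge2 : 2 <= p.
Variable h : E -> R.
Hypothesis h_ge0 : forall x, 0 <= h x.
Hypothesis h_norm : (\int[mu]_x (h x `^ p)%:E <= 1)%E.

(** The case $q=1$, where the factor containing [gamma] equals 1, is a Poincare inequality for
    nonnegative functions; the shift by [b] makes [T] nonnegative and preserves variance and
    gradient. The energy is at most 2 because $h^2\le 1+h^p$. *)
Lemma variance_le (T : E -> R) (b : R) : smooth M T ->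
  (forall x, `|T x| <= b) -> (forall x, grad_norm M T x <= h x) ->
  \int[mu]_x ((T x - \int[mu]_y T y) ^+ 2) <= 2 / beta.
Proof.
move=> sT Tb Th.
have mT := smooth_measurable sT.
have iT : mu.-integrable setT (EFin \o T) by exact: bounded_integrable mT Tb.
have iT2 : mu.-integrable setT (EFin \o (fun x => T x ^+ 2)).
  apply: (@bounded_integrable _ _ _ _ _ (b ^+ 2)); first exact: measurable_funX.
  by move=> x; rewrite normrX lerXn2r ?nnegrE// (le_trans _ (Tb x)).
pose g x := T x + b.
have sg : smooth M g := smoothD sT (smooth_cst b).
have gb x : 0 <= g x <= b *+ 2.
  by have := Tb x; rewrite /g ler_norml => /andP[? ?]; apply/andP; split; lra.
have gradg x : grad_norm M g x = grad_norm M T x.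
  apply: etrans (grad_norm_comp sT (is_derive_shift (T x) 1 b)) _.
  by rewrite normr1 mul1r.
have := @beckner_smooth _ _ _ M mu beta gamma 1 _ 1 g (cst 1)
  (fun x => h x `^ p) beck _ sg gb ltr01.
have -> : 2 - 1 = 1 :> R by lra.
rewrite powR1 mulr1 mul1r divr1.
have g0 x : 0 <= g x by have /andP[] := gb x.
have -> : \int[mu]_x (g x `^ 1) = \int[mu]_x g x.
  by apply: eq_Rintegral => x _; rewrite powRr1.
rewrite powR_mulrn; last by apply: Rintegral_ge0.
rewrite Rintegral_cst1 => poinc.
have {}poinc : beta * (\int[mu]_x (g x ^+ 2) - (\int[mu]_x g x) ^+ 2) <= 2.
  apply: poinc => //.
  - by rewrite lexx ltr1n.
  - exact: finite_measure_integrable_cst.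
  - by move=> x; exact: powR_ge0.
  - move=> x; rewrite gradg /cst mul1r.
    apply: (@le_trans _ _ (h x `^ 2)); last by rewrite powR_le1D ?p_ge2 ?ler0n.
    rewrite powR_mulrn// lerXn2r ?nnegrE//; exact: sqrtr_ge0.
rewrite ler_pdivlMr// mulrC; apply: le_trans poinc; rewrite ler_pM2l//.
have -> : \int[mu]_x g x = \int[mu]_x T x + b.
  rewrite RintegralD ?Rintegral_cst1//; exact: finite_measure_integrable_cst.
have := Rintegral_centered_sqr iT iT2 (- b).
under eq_Rintegral do rewrite opprK.
rewrite Rintegral_centered_sqr// => ->.
by rewrite le_eqVlt; apply/orP; left; apply/eqP; ring.
Qed.

(** Chosen to satisfy $\beta k^2\ge 9$ for the induction step, and $k\ge1$ and $k\ge 1+2/\beta$ for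
    exponents at most 2. *)
Let k := 3 + 3 / beta.

Let k_gt0 : 0 < k.
Proof. by rewrite ltr_pwDl ?divr_ge0// ltW. Qed.

Let bk2 : 9 <= beta * k ^+ 2.
Proof.
rewrite /k (_ : beta * _ = 9 * beta + 18 + 9 / beta); last first.
  by field; rewrite gt_eqF.
rewrite -addrA ler_wpDl ?mulr_ge0 ?(ltW beta_gt0)// ler_wpDr ?divr_ge0 ?(ltW beta_gt0)//; lra.
Qed.

Lemma moment_step (w : E -> R) (b r : R) : smooth M w ->
  (forall x, 1 <= w x <= b) -> (forall x, grad_norm M w x <= h x) ->
  2 <= r <= p ->
  \int[mu]_x (w x `^ (r - 1)) <= (k * (r - 1) `^ gamma^-1) `^ (r - 1) ->
  \int[mu]_x (w x `^ r) <= (k * r `^ gamma^-1) `^ r.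
Proof.
move=> sw wb wh /andP[r2 rp] IH.
have r0 : 0 < r by lra.
have /andP[g1 g2] := gamma12; have g0 : 0 < gamma by lra.
have w1 x : 1 <= w x by have /andP[] := wb x.
have w0 x : 0 < w x by exact: lt_le_trans (w1 x).
have wxb x : w x <= b by have /andP[] := wb x.
have b0 : 0 <= b by exact: le_trans (ltW (w0 point)) (wxb point).
pose y := r `^ (2 / gamma); have y0 : 0 < y by exact: powR_gt0.
pose a := k * r `^ gamma^-1; have a0 : 0 < a by rewrite mulr_gt0 ?powR_gt0.
have a2 : a ^+ 2 = k ^+ 2 * y.
  by rewrite exprMn -(powR_mulrn _ (powR_ge0 _ _)) -powRrM [_^-1 * _]mulrC.
pose A := a `^ r; have A0 : 0 < A by exact: powR_gt0.
pose q := 2 - 2 / r.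
pose g x := w x `^ (r / 2).
pose X := \int[mu]_x (w x `^ r).
have sg : smooth M g := smooth_powR (r / 2) w0 sw.
have gb x : 0 <= g x <= b `^ (r / 2).
  by rewrite powR_ge0 ge0_ler_powR ?nnegrE// ?divr_ge0 ?(ltW r0) ?(ltW (w0 x)) ?b0.
have mwr : measurable_fun setT ((fun x => w x `^ r) : borel E -> R).
  by exact: smooth_measurable (smooth_powR r w0 sw).
have iwr : mu.-integrable setT (EFin \o (fun x => w x `^ r)).
  apply: (@bounded_integrable _ _ _ _ _ (b `^ r)) => // x.
  by rewrite ger0_norm ?powR_ge0// ge0_ler_powR ?nnegrE ?(ltW r0) ?(ltW (w0 x)) ?b0.
(* Chosen so that $(r/2)^2w^{r-2}h^2=e\,w^{r-2}(ah)^2$, where [a] is the base of the target bound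
   [A]. *)
pose e := r ^+ 2 / 4 / a ^+ 2.
have e0 : 0 < e by rewrite !divr_gt0 ?exprn_gt0.
have gradg x : grad_norm M g x ^+ 2 <= e * (w x `^ r + A) + (e * A) * h x `^ p.
  have -> : grad_norm M g x = _ := grad_norm_comp sw (is_derive1_powR (r / 2) (w0 x)).
  rewrite exprMn real_normK ?num_real// exprMn.
  rewrite -(powR_mulrn _ (powR_ge0 _ _)) -powRrM.
  have -> : (r / 2 - 1) * 2%:R = r - 2 by field.
  apply: (@le_trans _ _ ((r / 2) ^+ 2 * w x `^ (r - 2) * h x ^+ 2)).
    apply: ler_wpM2l; first by rewrite mulr_ge0 ?sqr_ge0 ?powR_ge0.
    by rewrite lerXn2r ?nnegrE// sqrtr_ge0.
  have -> : (r / 2) ^+ 2 * w x `^ (r - 2) * h x ^+ 2 =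
      e * (w x `^ (r - 2) * (a * h x) ^+ 2).
    by rewrite /e; field; rewrite gt_eqF.
  have -> : e * (w x `^ r + A) + e * A * h x `^ p =
      e * (w x `^ r + A * (1 + h x `^ p)) by ring.
  (* Here $(ah)^r=Ah^r\le A(1+h^p)$, since it is the $p$-th moment of [h] that is controlled and
     $r\le p$. This accounts for the two copies of [A] in the estimates below. *)
  rewrite ler_pM2l//; apply: le_trans (powR_mul_sqr_le _ _ r2) _.
  - exact: ltW.
  - by rewrite mulr_ge0// ltW.
  - by rewrite powRM ?(ltW a0)// lerD2l ler_pM2l// powR_le1D// rp (ltW r0).
have q12 : 1 <= q < 2.
  rewrite /q gtrBl divr_gt0// andbT lerBrDr.
  have : 2 / r <= 1 by rewrite ler_pdivrMr// mul1r.
  lra.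
have iB : mu.-integrable setT (EFin \o (fun x => e * (w x `^ r + A))).
  exact: (integrableZl measurableT e (integrableD measurableT iwr
    (finite_measure_integrable_cst mu A measurableT))).
have := @beckner_smooth _ _ _ M mu beta gamma q _ (e * A) g
  _ (fun x => h x `^ p) beck q12 sg gb (mulr_gt0 e0 A0) iB _ _ h_norm gradg.
have -> : \int[mu]_x (e * (w x `^ r + A)) = e * (X + A).
  rewrite RintegralZl//; last first.
    exact: (integrableD measurableT iwr (finite_measure_integrable_cst mu A measurableT)).
  rewrite RintegralD// ?Rintegral_cst1//; exact: finite_measure_integrable_cst.
have -> : \int[mu]_x (g x ^+ 2) = X.
  apply: eq_Rintegral => x _; rewrite /g -powR_mulrn ?powR_ge0// -powRrM.
  by congr (_ `^ _); field.
have -> : \int[mu]_x (g x `^ q) = \int[mu]_x (w x `^ (r - 1)).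
  apply: eq_Rintegral => x _; rewrite /g -powRrM.
  by congr (_ `^ _); rewrite /q; field; rewrite gt_eqF.
set S := (X in _ * (_ - X)) => ineq.
have powM (t u v : R) : 0 <= u -> u <= v -> 0 <= t -> u `^ t <= v `^ t.
  by move=> u0 uv t0; rewrite ge0_ler_powR ?nnegrE// (le_trans u0).
(* The hypothesis at $r-1$ gives $S\le(k(r-1)^{1/\gamma})^r=(1-1/r)^{r/\gamma}A$. *)
have SA : S <= 2 / 3 * A.
  have qE : 2 / q = r / (r - 1).
    by rewrite /q; field; apply/and3P; split; rewrite gt_eqF//; lra.
  apply: (@le_trans _ _ ((k * (r - 1) `^ gamma^-1) `^ r)).
    have -> : (k * (r - 1) `^ gamma^-1) `^ r =
        ((k * (r - 1) `^ gamma^-1) `^ (r - 1)) `^ (r / (r - 1)).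
      rewrite -powRrM; congr (_ `^ _); field.
      by rewrite gt_eqF//; lra.
    rewrite /S qE; apply: powM; [|exact: IH|by rewrite divr_ge0//; lra].
    by apply: Rintegral_ge0 => x _; exact: powR_ge0.
  have -> : (r - 1) = (1 - r^-1) * r by field; rewrite gt_eqF.
  have ri : 0 <= 1 - r^-1 by rewrite subr_ge0 invf_le1//; lra.
  rewrite (powRM _ ri (ltW r0)) mulrCA (powRM _ (powR_ge0 _ _) (ltW a0)).
  rewrite -/A -powRrM ler_pM2r//.
  by rewrite mulrC powR_onem_inv_le ?g0//; lra.
have B0 x : 0 <= e * (w x `^ r + A).
  by rewrite mulr_ge0 ?addr_ge0 ?powR_ge0// ltW.
have {}ineq := ineq B0 (fun x => powR_ge0 _ _).
have qr : 2 - q = 2 / r by rewrite /q; lra.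
have z1 : 1 <= 2 `^ (2 / gamma).
  by rewrite -[leLHS](powRr0 2) ler_powR ?divr_ge0 ?(ltW g0)// ler1n.
have yE : (2 / r) `^ (2 / gamma - 1) = 2 `^ (2 / gamma) / y * (r / 2).
  rewrite powRB; last by apply/implyP => _; rewrite gt_eqF ?divr_gt0.
  have ry : r^-1 `^ (2 / gamma) = y^-1.
    by rewrite -[r^-1]powR_inv1 ?(ltW r0)// -powRrM mulN1r powRN.
  rewrite powRr1 ?divr_ge0 ?(ltW r0)// powRM ?invr_ge0 ?(ltW r0)// ry.
  by field; rewrite !gt_eqF.
(* Division by the common factor $r/(2y)$, where $y=r^{2/\gamma}$, cancels the explicit powers of
   [r]; the factor $2^{2/\gamma}\ge1$ is dropped further down. *)
have {}ineq : beta * 2 `^ (2 / gamma) * (X - S) <= (X + A + A) / k ^+ 2.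
  have z0 : 0 < r / 2 / y by rewrite !divr_gt0.
  rewrite -(ler_pM2l z0); move: ineq; rewrite qr yE /e a2 => ineq.
  rewrite [leLHS](_ : _ = beta * (2 `^ (2 / gamma) / y * (r / 2)) * (X - S)); last by ring.
  apply: le_trans ineq _; rewrite le_eqVlt; apply/orP; left; apply/eqP.
  by field; rewrite !gt_eqF.
(* If $X\le S$ then $X\le\frac23A$. Otherwise $X-S\ge0$, so its coefficient may be replaced by a
   smaller one. *)
have [XS|/ltW SX] := leP X S; first by rewrite -/X -/a -/A; lra.
have X0 : 0 <= X by apply: Rintegral_ge0 => x _; exact: powR_ge0.
have {}ineq : beta * k ^+ 2 * (X - S) <= X + A + A.
  move: ineq; rewrite ler_pdivlMr ?exprn_gt0//; apply: le_trans.
  rewrite -subr_ge0 (_ : _ - _ =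
    (2 `^ (2 / gamma) - 1) * (beta * k ^+ 2 * (X - S))); last by ring.
  by rewrite !mulr_ge0 ?subr_ge0 ?sqr_ge0// ltW.
(* Then $8X\le 9S+2A\le 6A+2A$, that is $X\le A$: the constants 9 and 2/3 fit exactly. *)
have : 9 * (X - S) <= X + A + A.
  by apply: le_trans ineq; rewrite ler_wpM2r// subr_ge0.
by rewrite -/X -/a -/A; lra.
Qed.

(** Exponents are real, so the induction runs over a natural number [n] with $s\le n+2$ and lowers
    [s] by one. It ends in $[1,2]$, where the second moment suffices because $w\ge1$. *)
Lemma moment_bound (w : E -> R) (b r : R) : smooth M w ->
  (forall x, 1 <= w x <= b) -> (forall x, grad_norm M w x <= h x) ->
  \int[mu]_x (w x ^+ 2) <= 1 + 2 / beta -> 1 <= r <= p ->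
  \int[mu]_x (w x `^ r) <= (k * r `^ gamma^-1) `^ r.
Proof.
move=> sw wb wh w2; have /andP[g1 g2] := gamma12.
have wge1 x : 1 <= w x by have /andP[] := wb x.
have wx0 x : 0 <= w x by exact: le_trans (wge1 x).
have wxb x : w x <= b by have /andP[] := wb x.
have bge0 : 0 <= b by exact: le_trans (wx0 point) (wxb point).
have iw s : 0 <= s -> mu.-integrable setT (EFin \o (fun x => w x `^ s)).
  move=> s0; apply: (@bounded_integrable _ _ _ _ _ (b `^ s)).
    apply: smooth_measurable (smooth_powR s _ sw) => x.
    exact: lt_le_trans (wge1 x).
  by move=> x; rewrite ger0_norm ?powR_ge0// ge0_ler_powR ?nnegrE.
have base s : 1 <= s <= 2 -> \int[mu]_x (w x `^ s) <= (k * s `^ gamma^-1) `^ s.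
  move=> /andP[s1 s2]; have s0 : 0 <= s by lra.
  apply: (@le_trans _ _ (\int[mu]_x (w x `^ 2))).
    apply: le_Rintegral => //; [exact: iw|exact: iw|].
    by move=> x _; apply: ler_powR.
  have -> : \int[mu]_x (w x `^ 2) = \int[mu]_x (w x ^+ 2).
    by apply: eq_Rintegral => x _; rewrite powR_mulrn.
  (* The chain is $1+2/\beta\le k\le ks^{1/\gamma}\le(ks^{1/\gamma})^s$, the last step because the
     base is at least 1 and $s\ge1$. *)
  apply: (le_trans w2); apply: (@le_trans _ _ k).
    by have := divr_gt0 ltr01 beta_gt0; rewrite /k; lra.
  have sg : 1 <= s `^ gamma^-1.
    by rewrite -[leLHS](powRr0 s) ler_powR// invr_ge0; lra.
  apply: (@le_trans _ _ (k * s `^ gamma^-1)); first by rewrite ler_peMr// ltW.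
  apply: le1r_powR => //; apply: (@le_trans _ _ k).
    by have := divr_gt0 ltr01 beta_gt0; rewrite /k; lra.
  by rewrite ler_peMr// ltW.
suff ind n : forall s, 1 <= s <= p -> s <= n%:R + 2 ->
    \int[mu]_x (w x `^ s) <= (k * s `^ gamma^-1) `^ s.
  move=> rp; apply: (ind (Num.truncn r).+1) => //.
  have : r < (Num.truncn r).+1%:R by exact: truncnS_gt.
  lra.
elim: n => [|n IH] s /andP[s1 sp] sn; first by apply: base; rewrite s1; lra.
have [s2|/ltW s2] := leP s 2; first by apply: base; rewrite s1.
apply: (moment_step sw wb wh); first by rewrite s2.
by apply: IH; [apply/andP; split; lra|move: sn; rewrite -natr1; lra].
Qed.

Lemma grad_norm_contraction (u : E -> R) (phi dphi : R -> R) (x : E) :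
  smooth M u -> (forall t : R, is_derive t 1 phi (dphi t)) ->
  (forall t, `|dphi t| <= 1) -> grad_norm M (phi \o u) x <= grad_norm M u x.
Proof.
move=> su dp dp1; rewrite (grad_norm_comp su (dp (u x))).
by rewrite ler_piMl ?sqrtr_ge0.
Qed.

(** The function $w=\sqrt{1+(u-m)^2}$ replaces $|u-m|$: it is smooth, at least 1, and a contraction
    of [u], so $|\nabla w|\le h$. Its second moment is 1 plus the variance of [u]. *)
Lemma bounded_central_moment (u : E -> R) (b : R) : smooth M u ->
  (forall x, `|u x| <= b) -> (forall x, grad_norm M u x <= h x) ->
  \int[mu]_x ((1 + (u x - \int[mu]_y u y) ^+ 2) `^ (p / 2)) <= (k * p `^ gamma^-1) `^ p.
Proof.
move=> su ub uh; set m := \int[mu]_y u y.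
have p0 : 0 <= p := le_trans (ler0n R 2) p_ge2.
have bge0 : 0 <= b by exact: le_trans (ub point).
pose phi (t : R) : R := (1 + (t - m) ^+ 2) `^ 2^-1.
pose dphi (t : R) : R := 2^-1 * (1 + (t - m) ^+ 2) `^ (2^-1 - 1) * ((t - m) *+ 2).
have s1 t : 1 <= 1 + (t - m) ^+ 2 by rewrite lerDl sqr_ge0.
have s0 t : 0 < 1 + (t - m) ^+ 2 by exact: lt_le_trans (s1 t).
have phi2 t : phi t ^+ 2 = 1 + (t - m) ^+ 2.
  by rewrite -powR_mulrn ?powR_ge0// -powRrM mulVf ?pnatr_eq0// powRr1// ltW.
have dphiP (t : R) : is_derive t 1 phi (dphi t).
  have dq : is_derive t 1 (fun t => 1 + (t - m) ^+ 2) ((t - m) *+ 2).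
    by apply: is_derive_eq; rewrite /GRing.scale /=; ring.
  have [dq1 dq2] := dq.
  by have := is_derive_comp_scalar dq1 (is_derive1_powR 2^-1 (s0 t)); rewrite dq2.
have dphi1 t : `|dphi t| <= 1.
  rewrite -[leRHS]normr1 -ler_sqr ?nnegrE// !real_normK ?num_real//.
  rewrite /dphi exprMn exprMn -(powR_mulrn _ (powR_ge0 _ _)) -powRrM.
  have -> : (2^-1 - 1) * 2 = - 1 :> R by field.
  rewrite powR_inv1; last exact: ltW.
  rewrite (_ : _ * _ = (t - m) ^+ 2 / (1 + (t - m) ^+ 2)); last by field; rewrite gt_eqF.
  by rewrite expr1n ler_pdivrMr// mul1r lerDr.
pose w := phi \o u.
have sw : smooth M w.
  have su' : smooth M (u \+ cst (- m)) := smoothD su (smooth_cst (- m)).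
  apply: (smooth_powR 2^-1) => [x|]; first exact: s0.
  exact: (smoothD (smooth_cst 1) (smoothM su' su')).
have w1 x : 1 <= w x.
  by rewrite -ler_sqr ?nnegrE ?powR_ge0// phi2 expr1n.
have wb x : 1 <= w x <= 1 + (b + `|m|) ^+ 2.
  (* A crude bound through $w\le w^2$, valid as $w\ge1$. *)
  rewrite w1 /=; apply: (@le_trans _ _ (w x ^+ 2)).
    by rewrite expr2 ler_peMl// (le_trans _ (w1 x)).
  rewrite phi2 lerD2l -[leLHS]real_normK ?num_real// lerXn2r ?nnegrE//.
    by rewrite addr_ge0.
  by rewrite (le_trans (ler_normB _ _))// lerD2r.
have wh x : grad_norm M w x <= h x.
  by apply: le_trans (uh x); exact: grad_norm_contraction dphiP dphi1.
have mu_ := smooth_measurable su.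
have iV : mu.-integrable setT (EFin \o (fun x => (u x - m) ^+ 2)).
  apply: (@bounded_integrable _ _ _ _ _ ((b + `|m|) ^+ 2)).
    by apply: measurable_funX; exact: measurable_funB.
  move=> x; rewrite normrX lerXn2r ?nnegrE ?addr_ge0//.
  by rewrite (le_trans (ler_normB _ _))// lerD2r.
have w2 : \int[mu]_x (w x ^+ 2) <= 1 + 2 / beta.
  have -> : \int[mu]_x (w x ^+ 2) = \int[mu]_x (1 + (u x - m) ^+ 2).
    by apply: eq_Rintegral => x _; exact: phi2.
  rewrite RintegralD//; last exact: finite_measure_integrable_cst.
  by rewrite Rintegral_cst1 lerD2l; exact: variance_le su ub uh.
have p1 : 1 <= p <= p by rewrite lexx andbT (le_trans _ p_ge2)// ler1n.
apply: le_trans (moment_bound sw wb wh w2 p1).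
rewrite le_eqVlt; apply/orP; left; apply/eqP; apply: eq_Rintegral => x _.
by rewrite /w /phi /= -powRrM mulrC.
Qed.

(** The estimates for the truncations are uniform in [n]. Bounded means and variances give $f\in
    L_2$ by Fatou's lemma, hence $f\in L_1$; dominated convergence with majorant $|f|$ yields
    convergence of the means, and a second use of Fatou's lemma gives the moment of [f]. *)
Lemma central_moment (f : E -> R) : smooth M f ->
  (forall x, grad_norm M f x <= h x) ->
  mu.-integrable setT (EFin \o (f : borel E -> R)) /\
  (\int[mu]_x (`|f x - \int[mu]_y f y| `^ p)%:E
     <= ((k * p `^ gamma^-1) `^ p)%:E)%E.
Proof.
move=> sf fh; have mf := smooth_measurable sf.
pose u n := trunc n.+1%:R^-1 \o f.
have e0 n : 0 < n.+1%:R^-1 :> R by rewrite invr_gt0.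
have su n : smooth M (u n) by exact: smooth_trunc.
have mu_ n : measurable_fun setT (u n : borel E -> R) := smooth_measurable (su n).
have ub n x : `|u n x| <= Num.sqrt n.+1%:R^-1^-1 by exact: normr_trunc_bounded.
have uh n x : grad_norm M (u n) x <= h x.
  apply: le_trans (fh x).
  exact: grad_norm_contraction (is_derive_trunc (e0 n)) (normr_dtrunc_le1 (e0 n)).
have uf n x : `|u n x| <= `|f x| by exact: normr_trunc_le.
have ucvg x : u n x @[n --> \oo] --> f x by exact: trunc_cvg.
have iu n : mu.-integrable setT (EFin \o (u n)).
  exact: bounded_integrable (mu_ n) (ub n).
have iu2 n : mu.-integrable setT (EFin \o (fun x => u n x ^+ 2)).
  apply: (@bounded_integrable _ _ _ _ _ (Num.sqrt n.+1%:R^-1^-1 ^+ 2)).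
    exact: measurable_funX.
  by move=> x; rewrite normrX lerXn2r ?nnegrE ?sqrtr_ge0.
pose m n := \int[mu]_x u n x.
have iV n : mu.-integrable setT (EFin \o (fun x => (u n x - m n) ^+ 2)).
  apply: (@bounded_integrable _ _ _ _ _ ((Num.sqrt n.+1%:R^-1^-1 + `|m n|) ^+ 2)).
    by apply: measurable_funX; exact: measurable_funB.
  move=> x; rewrite normrX lerXn2r ?nnegrE ?addr_ge0 ?sqrtr_ge0//.
  by rewrite (le_trans (ler_normB _ _))// lerD2r.
have var n : \int[mu]_x ((u n x - m n) ^+ 2) <= 2 / beta.
  exact: variance_le (su n) (ub n) (uh n).
(* The means m n are bounded because
   m^2 / (1 + f^2) <= 2 (u - m)^2 + 2 whenever |u| <= |f|. *)
pose kap x : R := (1 + f x ^+ 2)^-1.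
have f1 x : 1 <= 1 + f x ^+ 2 by rewrite lerDl sqr_ge0.
have kap0 x : 0 < kap x by rewrite invr_gt0 (lt_le_trans ltr01).
have mkap : measurable_fun setT (kap : borel E -> R).
  have -> : kap = (fun x => (1 + f x ^+ 2) `^ (-1)).
    by apply/funext => x; rewrite powR_inv1// (le_trans _ (f1 x)).
  apply: smooth_measurable; apply: (smooth_powR (-1)) => [x|].
    exact: lt_le_trans (f1 x).
  exact: (smoothD (smooth_cst 1) (smoothM sf sf)).
have ikap : mu.-integrable setT (EFin \o kap).
  apply: (@bounded_integrable _ _ _ _ _ 1) => // x.
  by rewrite ger0_norm ?(ltW (kap0 x))// invf_le1// (lt_le_trans _ (f1 x)).
pose K0 := \int[mu]_x kap x.
(* [kap] is positive everywhere; were its integral zero, the whole space would be a null set,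
   against total mass 1. *)
have K0_gt0 : 0 < K0.
  rewrite lt_neqAle Rintegral_ge0 ?andbT; last by move=> x _; exact: ltW.
  apply/eqP => K00.
  have : (\int[mu]_x `|(kap x)%:E| = 0)%E.
    have -> : (\int[mu]_x `|(kap x)%:E| = \int[mu]_x (kap x)%:E)%E.
      by apply: eq_integral => x _ /=; rewrite ger0_norm// ltW.
    by rewrite -[LHS]fineK ?integrable_fin_num// -/(Rintegral _ _ _) -/K0 -K00.
  move=> /ae_eq_integral_abs; move=> /(_ measurableT).
  have mk : measurable_fun setT (EFin \o kap : borel E -> \bar R) by exact/measurable_EFinP.
  move=> /(_ mk)[N [mN N0 subN]].
  have NT : N = setT.
    apply/seteqP; split=> // x _; apply: subN => /(_ I) /= /eqP.
    by rewrite eqe gt_eqF.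
  by move: N0; rewrite NT [X in X = _]probability_setT => /eqP; rewrite eqe oner_eq0.
have mbound n : m n ^+ 2 <= (4 / beta + 2) / K0.
  rewrite ler_pdivlMr//.
  rewrite -RintegralZl//.
  apply: (@le_trans _ _ (\int[mu]_x (2 * (u n x - m n) ^+ 2 + 2))).
    apply: le_Rintegral => //.
    - exact: (integrableZl measurableT (m n ^+ 2) ikap).
    - exact: (integrableD measurableT (integrableZl measurableT 2 (iV n))
        (finite_measure_integrable_cst mu 2 measurableT)).
    - move=> x _; rewrite ler_pdivrMr ?(lt_le_trans _ (f1 x))//.
      have uf2 : u n x ^+ 2 <= f x ^+ 2 by exact: sqr_trunc_le.
      have := mulr_ge0 (sqr_ge0 (u n x - m n)) (sqr_ge0 (f x)).
      (* $(2u-m)^2=2(u-m)^2+2u^2-m^2$, which with $u^2\le f^2$ gives $m^2\le2(u-m)^2+2f^2$; the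
         other terms are nonnegative. *)
      have := sqr_ge0 (2 * u n x - m n).
      move: uf2; set v := u n x; set w := f x; lra.
  rewrite RintegralD//; last 2 first.
  - exact: (integrableZl measurableT 2 (iV n)).
  - exact: finite_measure_integrable_cst.
  rewrite RintegralZl// Rintegral_cst1 lerD2r.
  by have := var n; rewrite -(ler_pM2l (@ltr0n R 2)) mulrA -natrM.
(* The bound is uniform in [n], because $\mu(u_n^2)$ is the variance of $u_n$ plus its squared
   mean. *)
have if2 : (\int[mu]_x (f x ^+ 2)%:E <= (2 / beta + (4 / beta + 2) / K0)%:E)%E.
  apply: (@fatou_bound _ _ _ mu (fun n x => u n x ^+ 2)).
  - by move=> n; exact: measurable_funX.
  - by move=> n x; exact: sqr_ge0.
  - by move=> x; rewrite expr2; under eq_fun do rewrite expr2; exact: cvgM.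
  - move=> n; rewrite -[leLHS]fineK; last exact: (integrable_fin_num measurableT (iu2 n)).
    rewrite lee_fin -/(Rintegral _ _ _).
    have := Rintegral_centered_sqr (iu n) (iu2 n) (m n); rewrite -/(m n).
    have := var n; have := mbound n; lra.
have if1 : mu.-integrable setT (EFin \o (f : borel E -> R)).
  apply/integrableP; split; first exact/measurable_EFinP.
  apply: (@le_lt_trans _ _ (\int[mu]_x (1 + 1 * f x ^+ 2)%:E)%E).
    apply: (@ge0_le_lower_integral _ _ _ mu (fun x => `|f x|)) => // x.
    by have := sqr_ge0 (`|f x| - 2^-1); rewrite -[f x ^+ 2]real_normK ?num_real//; nra.
  apply: le_lt_trans (lower_integral_le_affine mu (@ltr01 R) _ _ _ _ _) _.
  - exact: (@measurable_cst _ _ _ _ _ (1 : R)).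
  - by [].
  - by move=> x; exact: (sqr_ge0 (f x)).
  - by move=> x; rewrite mul1r ltW// ltr_pwDl ?sqr_ge0.
  - by [].
  - rewrite mul1e (_ : (\int[mu]_x (cst (1 : R) x)%:E)%E = 1%E).
      by apply: lte_add_pinfty; [exact: ltry|exact: le_lt_trans if2 (ltry _)].
    by have := integral_cst mu measurableT (1%R)%:E; rewrite mul1e [X in _ = X]probability_setT.
split=> //.
have mcvg : m n @[n --> \oo] --> \int[mu]_x f x.
  have [] := @dominated_convergence _ _ _ mu setT measurableT
    (fun n x => (u n x)%:E) (EFin \o f) (fun x => `|(f x)%:E|%E).
  - by move=> n; apply/measurable_EFinP.
  - exact/measurable_EFinP.
  - by apply: aeW => x _; apply: cvg_EFin; [exact: nearW|exact: ucvg].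
  - exact: integrable_abse.
  - by apply: aeW => x n _ /=; rewrite lee_fin.
  - move=> _ _ uE; apply: fine_cvg; rewrite fineK//.
    exact: (integrable_fin_num measurableT if1).
(* The larger integrand $(1+(f-\mu(f))^2)^{p/2}$ is the limit of the functions whose integrals
   [bounded_central_moment] controls. *)
apply: (@le_trans _ _ (\int[mu]_x ((1 + (f x - \int[mu]_y f y) ^+ 2) `^ (p / 2))%:E)%E).
  apply: ge0_le_lower_integral => x; first exact: powR_ge0.
  rewrite -[in leLHS](_ : 2 * (p / 2) = p); last by field.
  rewrite powRrM ge0_ler_powR ?nnegrE ?powR_ge0 ?addr_ge0 ?sqr_ge0//.
    by rewrite divr_ge0// (le_trans _ p_ge2).
  by rewrite powR_mulrn// real_normK ?num_real// lerDr.
pose F n x := (1 + (u n x - m n) ^+ 2) `^ (p / 2).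
have mF n : measurable_fun setT (F n : borel E -> R).
  apply: smooth_measurable.
  have su' : smooth M (u n \+ cst (- m n)) := smoothD (su n) (smooth_cst (- m n)).
  apply: (smooth_powR (p / 2)) => [x|]; first by rewrite ltr_pwDl// sqr_ge0.
  exact: (smoothD (smooth_cst 1) (smoothM su' su')).
have Fb n x : `|F n x| <= (1 + (Num.sqrt n.+1%:R^-1^-1 + `|m n|) ^+ 2) `^ (p / 2).
  rewrite [leLHS]ger0_norm ?powR_ge0//.
  apply: ge0_ler_powR; rewrite ?nnegrE ?addr_ge0 ?sqr_ge0//.
    by rewrite divr_ge0// (le_trans _ p_ge2).
  rewrite lerD2l -[leLHS]real_normK ?num_real// lerXn2r ?nnegrE ?addr_ge0 ?sqrtr_ge0//.
  by rewrite (le_trans (ler_normB _ _))// lerD2r.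
have iF n : mu.-integrable setT (EFin \o F n).
  exact: bounded_integrable (mF n) (Fb n).
apply: (@fatou_bound _ _ _ mu F) => //.
- by move=> n x; exact: powR_ge0.
- move=> x; set q := 1 + _ ^+ 2.
  have q0 : 0 < q by rewrite ltr_pwDl// sqr_ge0.
  have cq : 1 + (u n x - m n) ^+ 2 @[n --> \oo] --> q.
    apply: cvgD; first exact: cvg_cst.
    have ccvg : u n x - m n @[n --> \oo] --> f x - \int[mu]_y f y by exact: cvgB.
    by rewrite expr2; under eq_fun do rewrite expr2; exact: cvgM.
  exact: cvg_comp cq (@powR_continuous_gt0 _ (p / 2) _ q0).
- move=> n.
  rewrite -[leLHS]fineK; last exact: (integrable_fin_num measurableT (iF n)).
  rewrite lee_fin; exact: bounded_central_moment (su n) (ub n) (uh n).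
Qed.

End moments.

(** * Homogeneity: reduction to a gradient of norm at most one *)

Theorem corollary4p2 (R : realType) (beta : R) (beta_gt0 : 0 < beta) :
  exists C : R,
  forall (d : nat) (E : ptopologicalType) (M : riemannian R d E),
    ~ compact [set: E] ->
    connected [set: E] ->
    complete_riemannian M ->
    ricci_bounded_below M ->
  forall (o : E) (vol : {measure set (borel E) -> \bar R}),
    riemannian_volume M vol ->
  forall (V : E -> R) (gamma theta : R),
    continuous V ->
    1 < gamma <= 2 ->
    0 < theta ->
    (exists K : R, forall x : E,
       `|V x + theta * (dist M o x) `^ gamma| <= K) ->
  forall (Z : R) (mu : probability (borel E) R),
    (forall A : set (borel E), measurable A ->
       mu A = (\int[vol]_(x in A) (Z * expR (V x))%:E)%E) ->
    (forall (q : R) (g : E -> R) (e : R),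
       1 <= q < 2 -> (forall x, 0 <= g x) -> dirichlet_energy M mu g e ->
       beta * (2 - q) `^ (2 / gamma - 1) *
         ((\int[mu]_x (g x ^+ 2))
          - (\int[mu]_x (g x `^ q)) `^ (2 / q))
       <= (2 - q) * e) ->
  forall (f : E -> R) (r : R),
    smooth M f ->
    2 <= r ->
    ('N[mu]_(r%:E)[EFin \o grad_norm M f] < +oo)%E ->
    mu.-integrable [set: borel E] (EFin \o f) /\
    ('N[mu]_(r%:E)[EFin \o (fun x => f x - \int[mu]_y f y)%R]
     <= (C * r `^ gamma^-1)%:E * 'N[mu]_(r%:E)[EFin \o grad_norm M f])%E.
Proof.
(* The constant is the [k] of the moment estimates. *)
exists (3 + 3 / beta) => d E M _ _ _ _ o vol _ V gamma theta _ gamma12 _ _ Z mu _.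
move=> beck f r sf r2 Nfin.
have r0 : 0 < r by exact: lt_le_trans r2.
set kap := _ * _ `^ _.
have kap0 : 0 < kap by rewrite mulr_gt0 ?powR_gt0// ltr_pwDl// divr_ge0// ltW.
set N := Lnorm mu r%:E (EFin \o grad_norm M f).
have N0 : (0 <= N)%E by exact: Lnorm_ge0.
have fN : N = (fine N)%:E by rewrite fineK// ge0_fin_numE.
have g0 x : 0 <= grad_norm M f x by exact: sqrtr_ge0.
(* The gradient norm may be zero, so [f] is divided by an arbitrary [c] above it; the moment bound
   with $p=r$ then applies to $f/c$. *)
have scaled c : fine N < c -> mu.-integrable [set: borel E] (EFin \o f) /\
    (Lnorm mu r%:E (EFin \o (fun x => f x - \int[mu]_y f y)%R) <= (kap * c)%:E)%E.
  move=> Nc; have c0 : 0 < c by apply: le_lt_trans Nc; exact: fine_ge0.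
  pose h x := c^-1 * grad_norm M f x.
  have h0 x : 0 <= h x by rewrite mulr_ge0// invr_ge0 ltW.
  have h1 : (\int[mu]_x (h x `^ r)%:E <= 1)%E.
    have := lower_integralZl_le mu (powR_gt0 r (_ : 0 < c^-1))
      (fun x => powR_ge0 (grad_norm M f x) r).
    rewrite invr_gt0 => /(_ c0).
    under eq_integral do rewrite -powRM ?invr_ge0 ?(ltW c0)//.
    move=> /le_trans; apply.
    apply: (@le_trans _ _ ((c^-1 `^ r)%:E * (c `^ r)%:E)%E).
      rewrite lee_pmul2l ?lte_fin ?powR_gt0 ?invr_gt0//.
      by apply: integral_powR_le => //; [exact: ltW|rewrite -/N fN lee_fin ltW].
    by rewrite -EFinM -powRM ?invr_ge0 ?(ltW c0)// mulVf ?gt_eqF// powR1.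
  pose u x := c^-1 * f x.
  have su : smooth M u := smoothM (smooth_cst c^-1) sf.
  have uh x : grad_norm M u x <= h x.
    have dp : is_derive (f x) 1 (fun t => c^-1 * t) c^-1.
      by apply: is_derive_eq; rewrite /GRing.scale /=; ring.
    have -> : grad_norm M u x = _ := grad_norm_comp sf dp.
    by rewrite ger0_norm// invr_ge0 ltW.
  have [iu uM] := central_moment beta_gt0 gamma12 beck r2 h0 h1 su uh.
  have uE x : f x = c * u x by rewrite /u mulVKf// gt_eqF.
  have fE : (EFin \o f) = (fun x => c%:E * (u x)%:E)%E.
    by apply/funext => x; rewrite /= uE.
  have if1 : mu.-integrable [set: borel E] (EFin \o f).
    by rewrite fE; exact: (integrableZl measurableT c iu).
  split=> //; apply: Lnorm_le => //; first by rewrite mulr_ge0// ltW.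
  have mE : \int[mu]_x f x = c * \int[mu]_x u x.
    by rewrite -RintegralZl//; apply: eq_Rintegral => x _; exact: uE.
  have := lower_integralZl_le mu (powR_gt0 r c0)
    (fun x => powR_ge0 `|u x - \int[mu]_y u y| r).
  under eq_integral do rewrite -powRM ?(ltW c0)//
    -[X in X * `|_|](ger0_norm (ltW c0)) -normrM mulrBr -uE -mE.
  move=> /le_trans; apply.
  apply: (@le_trans _ _ ((c `^ r)%:E * (kap `^ r)%:E)%E).
    by rewrite lee_pmul2l ?lte_fin ?powR_gt0.
  by rewrite -EFinM -powRM ?(ltW c0) ?(ltW kap0)// mulrC.
split; first by have [] := scaled (fine N + 1); rewrite ?ltrDl.
(* Now [c] decreases to the norm: an excess of [e / kap] costs exactly [e] after multiplication by
   [kap]. *)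
rewrite [in leRHS]fN -EFinM; apply/lee_addgt0Pr => e e0.
have /scaled[_] : fine N < fine N + e / kap by rewrite ltrDl divr_gt0.
by rewrite mulrDr mulrCA divff ?gt_eqF// mulr1 EFinD.
Qed.
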